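(* Let $q$ be a prime power and let $n,k,r,\rho$ be positive integers with $n\mid k$, $r\mid k$ and $n_l\mid n$, where $n_l=r+\rho-1$; put $\mu=n/n_l$. Let $\mathcal{C}\subseteq\mathbb{F}_q^n$ be a linear code of length $n$, dimension $k/n$ and minimum Hamming distance $d$ with $(r,\rho)$ locality (in the Hamming metric) with disjoint local groups, i.e., there is a partition $\mathcal{S}=\{\mathcal{S}_1,\dots,\mathcal{S}_\mu\}$ of $[n]$ with $|\mathcal{S}_j|=n_l$ and $d_H(\mathcal{C}|_{\mathcal{S}_j})\geq\rho$ for all $j\in[\mu]$. Let $$\mathbb{C}=\{\mathrm{VDB}(\mathcal{T},\mathcal{S}):\ \mathcal{T}=(\mathbf{c}^{(1)},\dots,\mathbf{c}^{(n)}),\ \mathbf{c}^{(s)}\in\mathcal{C}\text{ for all }s\in[n]\}\subseteq\mathbb{F}_q^{n\times n}.$$ Then $\mathbb{C}$ is a linear code over $\mathbb{F}_q$ of $n\times n$ matrices, of dimension $k$ and minimum cover distance $d$, and it has $(r,\rho)$ cover-locality. Moreover, if $\mathcal{C}$ satisfies $d=n-\frac{k}{n}+1-\left(\left\lceil\frac{k}{nr}\right\rceil-1\right)(\rho-1)$, then $\mathbb{C}$ is optimal, i.e., $$d_C(\mathbb{C})=n-\frac{k}{n}+1-\left(\left\lceil\frac{k}{nr}\right\rceil-1\right)(\rho-1).$$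
   Context: Notation: $[n]=\{1,\dots,n\}$; $d_H$ is the minimum Hamming distance of a code; $\mathcal{C}|_{S}$ is the restriction of a code $\mathcal{C}$ to the coordinates in $S$ (taken in increasing order). Cover metric: for $\mathbf{E}=(e_{ij})\in\mathbb{F}_q^{m\times n}$, a line of $\mathbf{E}$ is a row or a column; lines are indexed by $[m+n]$, with $i\in[m]$ the $i$-th row and $m+j$ ($j\in[n]$) the $j$-th column. A cover of $\mathbf{E}$ is a set $\mathcal{X}\subseteq[m+n]$ such that $e_{ij}\neq0$ implies $i\in\mathcal{X}$ or $m+j\in\mathcal{X}$. The cover weight $\mathrm{wt}_C(\mathbf{E})$ is the minimum cardinality of a cover of $\mathbf{E}$. For a linear code of matrices, the minimum cover distance $d_C$ is the minimum cover weight of its nonzero elements. Cover-locality: a linear code $\mathbb{C}\subseteq\mathbb{F}_q^{n\times n}$ has $(r,\rho)$ cover-locality if for every line $i\in[2n]$ there exists a set $\Gamma(i)$ of indices of pairwise non-intersecting lines (only rows if $i$ is a row, only columns if $i$ is a column) such that (1) $i\in\Gamma(i)$; (2) $|\Gamma(i)|\leq r+\rho-1$; (3) $d_C(\mathbb{C}|_{\Gamma(i)})\geq\rho$, where $\mathbb{C}|_{\Gamma(i)}$ is the code of $|\Gamma(i)|\times n$ (or $n\times|\Gamma(i)|$) matrices obtained by restricting the codewords to the lines in $\Gamma(i)$. Vector-diagonal function: for $s\leq N$ and an ordered list of vectors $\mathbf{v}^{(1)},\dots,\mathbf{v}^{(s)}$ of length $N$, $\mathrm{vd}(\mathbf{v}^{(1)},\dots,\mathbf{v}^{(s)})$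 is the $N\times N$ array whose entry in column $j\in[N]$ and row $\big((i+j-2)\bmod N\big)+1$ is $v^{(i)}_j$, for $i\in[s]$, and whose other entries are $0$ (so the $i$-th vector is written on the $i$-th cyclic diagonal). The same definition applies when the entries $v^{(i)}_j$ are square matrices of equal size, giving a block matrix. Modified vector-diagonal function: with $n_l\mid n$, $\mu=n/n_l$, a partition $\mathcal{S}=\{\mathcal{S}_1,\dots,\mathcal{S}_\mu\}$ of $[n]$ into sets of size $n_l$, and an ordered list $\mathcal{T}=(\mathbf{c}^{(1)},\dots,\mathbf{c}^{(n)})$ of vectors in $\mathbb{F}_q^n$, let $\mathcal{T}_{i,j}$ (for $i,j\in[\mu]$) be the ordered list of the $n_l$ vectors $\mathbf{c}^{(s)}|_{\mathcal{S}_j}\in\mathbb{F}_q^{n_l}$ for $s=(i-1)n_l+1,\dots,in_l$. Then $$\mathrm{VDB}(\mathcal{T},\mathcal{S})=\mathrm{vd}\big([\mathrm{vd}(\mathcal{T}_{1,1}),\dots,\mathrm{vd}(\mathcal{T}_{1,\mu})],\ \dots,\ [\mathrm{vd}(\mathcal{T}_{\mu,1}),\dots,\mathrm{vd}(\mathcal{T}_{\mu,\mu})]\big)\in\mathbb{F}_q^{n\times n},$$ where the outer $\mathrm{vd}$ acts on $\mu$ vectors of length $\mu$ whose entries are $n_l\times n_l$ matrices. *)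

(* Defs.v *)
From HB Require Import structures.
From mathcomp Require Import all_boot all_order all_algebra.
From mathcomp Require Import constructive_ereal.

Set Implicit Arguments.
Unset Strict Implicit.
Unset Printing Implicit Defensive.

Import Order.TTheory GRing.Theory Num.Theory.

Local Open Scope ring_scope.

(* All indices are 0-based: [n] is 'I_n, and the lines of an
   m x n matrix are indexed by 'I_(m + n), row i being [lshift n i] and
   column j being [rshift m j]. *)

Definition is_cover (F : nzRingType) (m n : nat) (E : 'M[F]_(m, n))
    (X : {set 'I_(m + n)}) : bool :=
  [forall i, forall j,
     (E i j != 0) ==> (lshift n i \in X) || (rshift m j \in X)].

(* The set of all lines is always a cover, so the arg min is meaningful. *)
Definition cover_weight (F : nzRingType) (m n : nat) (E : 'M[F]_(m, n)) : nat :=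
  #|[arg min_(X < [set: 'I_(m + n)] | is_cover E X) #|X|]|.

Definition hamming_distance (F : eqType) (n : nat) (x y : 'rV[F]_n) : nat :=
  #|[set j | x 0 j != y 0 j]|.

(* Minimum distances take values in Z extended with infinities, the minimum of
   the empty set being +oo; this value only occurs for codes with at most one
   word (resp. no nonzero word). *)
Definition min_hamming_distance (F : finFieldType) (n : nat)
    (C : {set 'rV[F]_n}) : \bar int :=
  \big[Order.min/+oo%E]_(x in C) \big[Order.min/+oo%E]_(y in C | x != y)
     ((hamming_distance x y)%:Z)%:E.

Definition min_cover_distance (F : finFieldType) (m n : nat)
    (C : {set 'M[F]_(m, n)}) : \bar int :=
  \big[Order.min/+oo%E]_(E in C | E != 0) ((cover_weight E)%:Z)%:E.

Definition linear_code (F : finFieldType) (m n : nat)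
    (C : {set 'M[F]_(m, n)}) (K : nat) : Prop :=
  exists U : {vspace 'M[F]_(m, n)}, C = [set x in U] /\ \dim U = K.

(* [enum_val] lists a subset of 'I_n in increasing order.  On row vectors,
   [restr_cols] is the restriction to a set of coordinates. *)
Definition restr_cols (F : Type) (m n : nat) (G : {set 'I_n})
    (M : 'M[F]_(m, n)) : 'M[F]_(m, #|G|) :=
  colsub (fun t : 'I_#|G| => enum_val t) M.

Definition restr_rows (F : Type) (m n : nat) (G : {set 'I_m})
    (M : 'M[F]_(m, n)) : 'M[F]_(#|G|, n) :=
  rowsub (fun t : 'I_#|G| => enum_val t) M.

(* The first conjunct concerns the lines that are rows, the second one those
   that are columns; a set of pairwise non-intersecting lines containing a
   given row (resp. column) is a set of rows (resp. columns). *)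
Definition cover_locality (F : finFieldType) (n : nat) (C : {set 'M[F]_n})
    (r rho : nat) : Prop :=
  (forall i : 'I_n, exists G : {set 'I_n},
      [/\ i \in G, (#|G| <= r + rho - 1)%N
        & ((rho%:Z)%:E <= min_cover_distance [set restr_rows G M | M in C])%E])
  /\
  (forall j : 'I_n, exists G : {set 'I_n},
      [/\ j \in G, (#|G| <= r + rho - 1)%N
        & ((rho%:Z)%:E <= min_cover_distance [set restr_cols G M | M in C])%E]).

(* The 0-based form of "v^(i)_j is in column j and row ((i+j-2) mod N) + 1".
   For s <= N the sum has at most one term. *)
Definition vd (A : nmodType) (s N : nat) (v : 'I_s -> 'rV[A]_N) : 'M[A]_N :=
  \matrix_(a, b) \sum_(i < s | (a == (i + b) %% N :> nat)%N) v i 0 b.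

Lemma sum_blocks (n nl : nat) (hdvd : (nl %| n)%N) :
  (\sum_(i < n %/ nl) nl)%N = n.
Proof. by rewrite sum_nat_const card_ord divnK. Qed.

Definition block_index (n nl : nat) (hdvd : (nl %| n)%N)
    (i : 'I_(n %/ nl)) (t : 'I_nl) : 'I_n :=
  cast_ord (sum_blocks hdvd) (@tagnat.Rank _ (fun=> nl) i t).

Lemma val_block_index (n nl : nat) (hdvd : (nl %| n)%N)
    (i : 'I_(n %/ nl)) (t : 'I_nl) :
  block_index hdvd i t = (i * nl + t)%N :> nat.
Proof.
rewrite [LHS](@tagnat.RankEsum _ (fun=> nl)); congr (_ + _)%N.
rewrite sum_nat_const; congr (_ * _)%N.
rewrite -sum1_card (eq_bigl (fun j : 'I__ => (j < i)%N)); last by [].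
rewrite -[RHS]card_ord -sum1_card.
by rewrite (big_ord_widen _ (fun=> 1%N) (ltnW (ltn_ord i))).
Qed.

(* The list T_{i,j}. *)
Definition VDB_list (F : nmodType) (n nl : nat) (hdvd : (nl %| n)%N)
    (S : 'I_(n %/ nl) -> {set 'I_n}) (hS : forall j, #|S j| = nl)
    (T : 'I_n -> 'rV[F]_n) (i j : 'I_(n %/ nl)) (t : 'I_nl) : 'rV[F]_nl :=
  castmx (erefl, hS j) (restr_cols (S j) (T (block_index hdvd i t))).

Definition VDB (F : nmodType) (n nl : nat) (hdvd : (nl %| n)%N)
    (S : 'I_(n %/ nl) -> {set 'I_n}) (hS : forall j, #|S j| = nl)
    (T : 'I_n -> 'rV[F]_n) : 'M[F]_n :=
  let B : 'M['M[F]_nl]_(n %/ nl) :=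
    vd (fun i : 'I_(n %/ nl) => \row_j vd (VDB_list hdvd hS T i j)) in
  castmx (sum_blocks hdvd, sum_blocks hdvd)
    (\mxblock_(i < n %/ nl, j < n %/ nl) B i j).

Definition VDB_code (F : finFieldType) (n nl : nat) (hdvd : (nl %| n)%N)
    (S : 'I_(n %/ nl) -> {set 'I_n}) (hS : forall j, #|S j| = nl)
    (C : {set 'rV[F]_n}) : {set 'M[F]_n} :=
  [set VDB hdvd hS T | T : {ffun 'I_n -> 'rV[F]_n} in ffun_on (mem C)].

Definition lrc_bound (n k r rho : nat) : int :=
  n%:Z - (k %/ n)%:Z + 1
  - (Num.ceil (k%:R / (n * r)%N%:R : rat) - 1) * (rho%:Z - 1).

(* Main.v *)
(** The nonzero entries of [VDB T S] are those of the words of [T], each word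
    being spread over a set of positions that meets every row and every column
    exactly once.  A line therefore covers at most one entry of a given word, so
    the cover weight of a nonzero matrix is at least the Hamming weight of any
    word in [T]; a minimum weight word completed by zero words attains [d].
    Moreover the part of a word supported by a local group [S j] stays inside
    one block row and one block column, so the block rows and the block columns
    are the groups of lines required by cover-locality. *)

Require Import Defs.
From mathcomp Require Import all_boot all_order all_algebra.
From mathcomp Require Import finfield.
From mathcomp Require Import constructive_ereal.

Set Implicit Arguments.
Unset Strict Implicit.
Unset Printing Implicit Defensive.

Import Order.TTheory GRing.Theory Num.Theory.

Local Open Scope ring_scope.

(** * Cover weight and minimum distances *)

Lemma mx_neq0 (F : nzRingType) (m n : nat) (E : 'M[F]_(m, n)) :
  E != 0 -> exists x y, E x y != 0.
Proof.
move=> E0; have [/existsP[x /existsP[y nz]]|none] :=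
    boolP [exists x, exists y, E x y != 0]; first by exists x, y.
case/eqP: E0; apply/matrixP=> x y; rewrite mxE; apply/eqP.
by apply: contraNT none => nz; apply/existsP; exists x; apply/existsP; exists y.
Qed.

Lemma cover_weight_le (F : nzRingType) (m n : nat) (E : 'M[F]_(m, n))
    (X : {set 'I_(m + n)}) : is_cover E X -> (cover_weight E <= #|X|)%N.
Proof.
rewrite /cover_weight; case: arg_minnP => [|Y _ Ymin]; last exact: Ymin.
by apply/forallP=> i; apply/forallP=> j; rewrite !inE implybT.
Qed.

(** The easy half of König's theorem: nonzero entries in distinct rows and distinct columns need
    pairwise distinct lines to cover them. *)
Lemma cover_weight_matching (F : nzRingType) (m n : nat) (E : 'M[F]_(m, n))
    (A : finType) (D : {set A}) (f : A -> 'I_m) (g : A -> 'I_n) :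
  {in D &, injective f} -> {in D &, injective g} ->
  (forall x, x \in D -> E (f x) (g x) != 0) -> (#|D| <= cover_weight E)%N.
Proof.
move=> injf injg nz; rewrite /cover_weight.
case: arg_minnP => [|X /forallP covX _].
  by apply/forallP=> i; apply/forallP=> j; rewrite !inE implybT.
(* [h] sends each entry to a line of [X] covering it; a row index never equals a column index, so
   [h] inherits injectivity from [f] and [g]. *)
pose h x := if lshift n (f x) \in X then lshift n (f x) else rshift m (g x).
have injh : {in D &, injective h}.
  move=> x y xD yD; rewrite /h; case: ifP => _; case: ifP => _.
  - by move/lshift_inj/injf => ->.
  - by move/eqP; rewrite eq_lrshift.
  - by move/eqP; rewrite eq_rlshift.
  - by move/rshift_inj/injg => ->.
rewrite -(card_in_imset injh) subset_leq_card //.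
apply/subsetP=> _ /imsetP[x xD ->]; rewrite /h; case: ifP => // fxX.
by have /forallP/(_ (g x)) := covX (f x); rewrite nz //= fxX.
Qed.

Lemma cover_weight_le_cols (F : nzRingType) (m n : nat) (E : 'M[F]_(m, n))
    (Y : {set 'I_n}) :
  (forall i j, E i j != 0 -> j \in Y) -> (cover_weight E <= #|Y|)%N.
Proof.
move=> hY; rewrite -(card_imset _ (@rshift_inj m n)).
apply: cover_weight_le; apply/forallP=> i; apply/forallP=> j.
by apply/implyP=> /hY jY; rewrite imset_f // orbT.
Qed.

Lemma min_cover_distance_ge (F : finFieldType) (m n d : nat)
    (C : {set 'M[F]_(m, n)}) :
  (forall E, E \in C -> E != 0 -> (d <= cover_weight E)%N) ->
  ((d%:Z)%:E <= min_cover_distance C)%E.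
Proof.
move=> h; apply: le_bigmin => [|E /andP[EC E0]]; first exact: leey.
by rewrite lee_fin lez_nat h.
Qed.

Lemma min_cover_distance_le (F : finFieldType) (m n d : nat)
    (C : {set 'M[F]_(m, n)}) (E : 'M[F]_(m, n)) :
  E \in C -> E != 0 -> (cover_weight E <= d)%N ->
  (min_cover_distance C <= (d%:Z)%:E)%E.
Proof.
move=> EC E0 wE; apply: (bigmin_inf E); first by rewrite EC.
by rewrite lee_fin lez_nat.
Qed.

Lemma min_hamming_distance_le (F : finFieldType) (n d : nat)
    (C : {set 'rV[F]_n}) (x y : 'rV[F]_n) :
  ((d%:Z)%:E <= min_hamming_distance C)%E ->
  x \in C -> y \in C -> x != y -> (d <= hamming_distance x y)%N.
Proof.
move=> /bigmin_geP[_ /(_ x)] + xC yC xy => /(_ xC)/bigmin_geP[_ /(_ y)].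
by rewrite yC xy lee_fin lez_nat; apply.
Qed.

Lemma min_hamming_distance_attained (F : finFieldType) (n d : nat)
    (C : {set 'rV[F]_n}) :
  min_hamming_distance C = (d%:Z)%:E ->
  exists x y, [/\ x \in C, y \in C, x != y & hamming_distance x y = d].
Proof.
move=> hd.
have [/existsP[x /existsP[y /and4P[xC yC xy /eqP xyd]]]|] :=
    boolP [exists x, exists y, [&& x \in C, y \in C, x != y
                                 & hamming_distance x y == d]].
  by exists x, y.
rewrite negb_exists => /forallP none.
(* Distances are integers: if none equals [d], all are at least [d + 1], and so is the minimum. The
   default [+oo] also satisfies this bound. *)
suff : ((d.+1%:Z)%:E <= min_hamming_distance C)%E.
  by rewrite hd lee_fin lez_nat ltnn.
apply: le_bigmin => [|x xC]; first exact: leey.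
apply: le_bigmin => [|y /andP[yC xy]]; first exact: leey.
rewrite lee_fin lez_nat ltn_neqAle (@min_hamming_distance_le _ _ _ C) ?hd //.
have := none x; rewrite negb_exists => /forallP/(_ y).
by rewrite xC yC xy /= eq_sym => ->.
Qed.

(** * Linear codes and their cardinality *)

Lemma linear_code_card (F : finFieldType) (m n k : nat)
    (C : {set 'M[F]_(m, n)}) : linear_code C k -> #|C| = (#|F| ^ k)%N.
Proof.
by case=> U [-> <-]; rewrite -card_vspace; apply: eq_card => x; rewrite inE.
Qed.

(** A set closed under linear combinations is its own span, and since [#|F| > 1] its size determines
    the dimension. Counting thus replaces the construction of a basis. *)
Lemma linear_code_of_card (F : finFieldType) (m n k : nat)
    (C : {set 'M[F]_(m, n)}) :
  0 \in C -> (forall a, {in C &, forall x y, a *: x + y \in C}) ->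
  #|C| = (#|F| ^ k)%N -> linear_code C k.
Proof.
move=> C0 Clin cardC.
have Cspan : C = [set x in <<enum C>>%VS].
  apply/setP=> x; rewrite inE; apply/idP/idP => [xC|].
    by rewrite memv_span ?mem_enum.
  move=> /(coord_span (X := in_tuple (enum C))) ->.
  elim/big_ind : _ => // [u v uC vC|i _]; first by rewrite -[u]scale1r Clin.
  by rewrite -[_ *: _]addr0 Clin // -mem_enum mem_nth.
exists <<enum C>>%VS; split=> //; apply/eqP.
rewrite -(eqn_exp2l _ _ (finNzRing_gt1 F)) -card_vspace -cardC {2}Cspan.
by apply/eqP/eq_card => x; rewrite inE.
Qed.

Lemma linear_code0 (F : finFieldType) (m n k : nat) (C : {set 'M[F]_(m, n)}) :
  linear_code C k -> 0 \in C.
Proof. by case=> U [-> _]; rewrite inE mem0v. Qed.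

Lemma linear_codeP (F : finFieldType) (m n k : nat) (C : {set 'M[F]_(m, n)})
    (a : F) : linear_code C k -> {in C &, forall x y, a *: x + y \in C}.
Proof.
by case=> U [-> _] x y; rewrite !inE => xU yU; rewrite memvD // memvZ.
Qed.

(* The row in which [vd] writes the [j]-th entry of the [i]-th vector. *)
Definition cyc (N : nat) (i j : 'I_N) : 'I_N :=
  Ordinal (ltn_pmod (i + j) (leq_ltn_trans (leq0n i) (ltn_ord i))).

Lemma cycC (N : nat) (i j : 'I_N) : cyc i j = cyc j i.
Proof. by apply: val_inj; rewrite /= addnC. Qed.

Lemma cyc_inj (N : nat) (i : 'I_N) : injective (cyc i).
Proof.
move=> j j' [/eqP]; rewrite eqn_modDl !modn_small // => /eqP; exact: val_inj.
Qed.

Lemma cyc_injl (N : nat) (j : 'I_N) : injective (fun i => cyc i j).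
Proof. by move=> i i' /=; rewrite ![cyc _ j]cycC => /cyc_inj. Qed.

Lemma cycP (N : nat) (a j : 'I_N) : exists i, a = cyc i j.
Proof.
by have [g _ gK] := injF_bij (@cyc_injl N j); exists (g a); rewrite gK.
Qed.

(** With as many vectors as columns, the cyclic diagonals tile the array, so the defining sum has
    exactly one term. *)
Lemma vdE (A : nmodType) (N : nat) (v : 'I_N -> 'rV[A]_N) (i b : 'I_N) :
  vd v (cyc i b) b = v i 0 b.
Proof.
rewrite mxE (eq_bigl (pred1 i)) ?big_pred1_eq // => i'.
rewrite -[_ == _]/(cyc i b == cyc i' b).
by rewrite (inj_eq (@cyc_injl N b)) eq_sym.
Qed.

(** * Entries of [VDB] in block coordinates *)

Section Placement.

Context (F : finFieldType) (n nl : nat) (hdvd : (nl %| n)%N).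
Context (S : 'I_(n %/ nl) -> {set 'I_n}) (hS : forall j, #|S j| = nl).

Local Notation pos := ('I_(n %/ nl) * 'I_nl)%type.

(** A pair (block, offset) names a word of [T], a row or a column through [line], and an entry of a
    word through [coordinate]. *)
Definition line (p : pos) : 'I_n := block_index hdvd p.1 p.2.

Definition coordinate (p : pos) : 'I_n :=
  enum_val (cast_ord (esym (hS p.1)) p.2).

Definition cyc2 (p p' : pos) : pos := (cyc p.1 p'.1, cyc p.2 p'.2).

(** Here [s] selects the word and [p] its entry. The outer [vd] shifts the block and the inner one
    the offset, hence the componentwise [cyc2]. *)
Lemma VDB_entry (T : 'I_n -> 'rV[F]_n) (s p : pos) :
  VDB hdvd hS T (line (cyc2 s p)) (line p) = T (line s) 0 (coordinate p).
Proof.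
case: s p => [i t] [j b]; rewrite /VDB /line /block_index castmxE !cast_ordK.
set M := mxblock _; have := mxblockK
  (vd (fun i => \row_j vd (VDB_list hdvd hS T i j)) : 'I__ -> 'I__ -> _)
  (cyc i j) j.
move=> /matrixP/(_ (cyc t b) b); rewrite [LHS]mxE => ->.
rewrite vdE mxE vdE /VDB_list castmxE mxE /=.
by congr (T _ _ _); rewrite ord1.
Qed.

Lemma line_inj : injective line.
Proof.
move=> [i t] [i' t'] /(congr1 (@nat_of_ord n)); rewrite !val_block_index => eqv.
have nl_gt0 : (0 < nl)%N by apply: leq_ltn_trans (ltn_ord t).
have := congr1 (modn^~ nl) eqv; rewrite /= !modnMDl !modn_small // => et.
have := congr1 (divn^~ nl) eqv; rewrite /= !divnMDl //.
rewrite (divn_small (ltn_ord t)) (divn_small (ltn_ord t')) !addn0 => ei.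
by congr (_, _); apply: val_inj.
Qed.

Lemma card_pos : #|{: pos}| = n.
Proof. by rewrite card_prod !card_ord divnK. Qed.

Lemma lineP (x : 'I_n) : exists p, x = line p.
Proof.
have [|g _ gK] := inj_card_bij line_inj; first by rewrite card_pos card_ord.
by exists (g x); rewrite gK.
Qed.

(** With [lineP], this brings any entry into the form of [VDB_entry]: in the column of [p], every
    row is reached by some word. *)
Lemma cyc2P (q p : pos) : exists s, q = cyc2 s p.
Proof.
case: q => a1 a2; have [i ->] := cycP a1 p.1; have [t ->] := cycP a2 p.2.
by exists (i, t).
Qed.

Lemma cyc2_inj (s : pos) : injective (cyc2 s).
Proof.
move=> [j b] [j' b'] e; congr (_, _).
  exact: cyc_inj (congr1 fst e).
exact: cyc_inj (congr1 snd e).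
Qed.

Lemma coordinateP (j : 'I_(n %/ nl)) (x : 'I_n) :
  x \in S j -> exists b, x = coordinate (j, b).
Proof.
move=> xS; exists (cast_ord (hS j) (enum_rank_in xS x)).
by rewrite /coordinate cast_ordK enum_rankK_in.
Qed.

Lemma VDB_neq0 (T : 'I_n -> 'rV[F]_n) (x y : 'I_n) :
  VDB hdvd hS T x y != 0 ->
  exists s p, [/\ x = line (cyc2 s p), y = line p
                & T (line s) 0 (coordinate p) != 0].
Proof.
have [q ->] := lineP x; have [p ->] := lineP y; have [s ->] := cyc2P q p.
by rewrite VDB_entry => nz; exists s, p.
Qed.

Lemma VDB_linear (a : F) (T T' : 'I_n -> 'rV[F]_n) :
  VDB hdvd hS (fun i => a *: T i + T' i) = a *: VDB hdvd hS T + VDB hdvd hS T'.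
Proof.
apply/matrixP=> x y; have [q ->] := lineP x; have [p ->] := lineP y.
by have [s ->] := cyc2P q p; rewrite !(mxE, VDB_entry).
Qed.

Lemma VDB0 : VDB hdvd hS (fun=> 0 : 'rV[F]_n) = 0.
Proof.
apply/matrixP=> x y; have [q ->] := lineP x; have [p ->] := lineP y.
by have [s ->] := cyc2P q p; rewrite VDB_entry !mxE.
Qed.

(** Links lists given as plain functions to the finite functions that index [VDB_code]. *)
Lemma VDB_ext (T T' : 'I_n -> 'rV[F]_n) :
  T =1 T' -> VDB hdvd hS T = VDB hdvd hS T'.
Proof.
move=> eT; apply/matrixP=> x y; have [q ->] := lineP x; have [p ->] := lineP y.
by have [s ->] := cyc2P q p; rewrite !VDB_entry eT.
Qed.

Lemma VDB_codeP (C : {set 'rV[F]_n}) (T : 'I_n -> 'rV[F]_n) :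
  (forall i, T i \in C) -> VDB hdvd hS T \in VDB_code hdvd hS C.
Proof.
move=> TC; apply/imsetP; exists (finfun T).
  by apply/ffun_onP=> i; rewrite ffunE.
by apply: VDB_ext => i; rewrite ffunE.
Qed.

(** * Block rows, block columns and cover-locality *)

Definition block_lines (i : 'I_(n %/ nl)) : {set 'I_n} :=
  [set line (i, t) | t : 'I_nl].

Lemma block_lines_mem i t : line (i, t) \in block_lines i.
Proof. exact: imset_f. Qed.

Lemma card_block_lines i : #|block_lines i| = nl.
Proof. by rewrite card_imset ?card_ord // => t t' /line_inj[]. Qed.

Definition block_rank i (t : 'I_nl) : 'I_#|block_lines i| :=
  enum_rank_in (block_lines_mem i t) (line (i, t)).

Lemma block_rankK i t : enum_val (block_rank i t) = line (i, t).
Proof. by rewrite enum_rankK_in ?block_lines_mem. Qed.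

Lemma block_rank_inj i : injective (block_rank i).
Proof.
move=> t t' /(congr1 enum_val); rewrite !block_rankK.
by move/line_inj => [].
Qed.

Lemma line_fst_inj (i : 'I_(n %/ nl)) : injective (fun t => line (i, t)).
Proof. by move=> t t' /line_inj[]. Qed.

Lemma block_lines_val i (u : 'I_#|block_lines i|) :
  exists t, enum_val u = line (i, t).
Proof. by have /imsetP[t _ ->] := enum_valP u; exists t. Qed.

Section LocalGroup.

Context (C : {set 'rV[F]_n}) (rho : nat) (C0 : 0 \in C).
Context (hSloc : forall j, ((rho%:Z)%:E <=
  min_hamming_distance [set restr_cols (S j) c | c in C])%E).

Lemma local_weight (c : 'rV[F]_n) (j : 'I_(n %/ nl)) (b : 'I_nl) :
  c \in C -> c 0 (coordinate (j, b)) != 0 ->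
  (rho <= #|[set b' | (c 0 (coordinate (j, b')) != 0)%R]|)%N.
Proof.
move=> cC nz.
have nz' : restr_cols (S j) c != restr_cols (S j) 0.
  apply: contraNneq nz => /rowP/(_ (cast_ord (esym (hS j)) b)).
  by rewrite !mxE => ->.
apply: leq_trans (min_hamming_distance_le (hSloc j) _ _ nz') _;
  try exact: imset_f.
rewrite /hamming_distance -(card_imset _ (@cast_ord_inj _ _ (hS j))).
apply/subset_leq_card/subsetP=> _ /imsetP[u + ->]; rewrite !inE !mxE.
by rewrite /coordinate cast_ordK.
Qed.

(** The word [s] behind the nonzero entry has at least [rho] nonzero symbols in the group [q.1].
    They all lie in block [(p.1, q.1)], on the cyclic diagonal [s.2], hence [f] is [cyc s.2]. This
    serves block rows and block columns alike. *)
Lemma VDB_local (T : 'I_n -> 'rV[F]_n) (p q : pos) :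
  (forall i, T i \in C) -> VDB hdvd hS T (line p) (line q) != 0 ->
  exists (D : {set 'I_nl}) (f : 'I_nl -> 'I_nl),
    [/\ (rho <= #|D|)%N, injective f
    & forall b, b \in D ->
        VDB hdvd hS T (line (p.1, f b)) (line (q.1, b)) != 0].
Proof.
move=> TC; have [s ->] := cyc2P p q; case: q => j b; rewrite VDB_entry => nz.
exists [set b' | T (line s) 0 (coordinate (j, b')) != 0], (cyc s.2).
split; [exact: local_weight nz | exact: cyc_inj | move=> b'].
by rewrite inE -VDB_entry.
Qed.

Lemma block_rows_distance i :
  ((rho%:Z)%:E <= min_cover_distance
     [set restr_rows (block_lines i) M | M in VDB_code hdvd hS C])%E.
Proof.
apply: min_cover_distance_ge => _ /imsetP[_ /imsetP[T /ffun_onP TC ->] ->].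
move=> /mx_neq0[u [y]]; rewrite mxE.
have [t ->] := block_lines_val u; have [q ->] := lineP y.
move=> /(VDB_local TC)[D [f [rhoD injf nz]]]; apply: leq_trans rhoD _.
apply: (cover_weight_matching (f := block_rank i \o f)
                              (g := fun b => line (q.1, b))).
- by apply: in2W; apply: inj_comp injf; apply: block_rank_inj.
- by apply: in2W; apply: line_fst_inj.
- by move=> b bD; rewrite mxE /= block_rankK nz.
Qed.

Lemma block_cols_distance j :
  ((rho%:Z)%:E <= min_cover_distance
     [set restr_cols (block_lines j) M | M in VDB_code hdvd hS C])%E.
Proof.
apply: min_cover_distance_ge => _ /imsetP[_ /imsetP[T /ffun_onP TC ->] ->].
move=> /mx_neq0[x [u]]; rewrite mxE.
have [b ->] := block_lines_val u; have [p ->] := lineP x.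
move=> /(VDB_local TC)[D [f [rhoD injf nz]]]; apply: leq_trans rhoD _.
apply: (cover_weight_matching (f := fun b => line (p.1, f b))
                              (g := block_rank j)).
- by apply: in2W; exact: inj_comp (@line_fst_inj p.1) injf.
- by apply: in2W; apply: block_rank_inj.
- by move=> b' bD; rewrite mxE /= block_rankK nz.
Qed.

Lemma VDB_cover_locality (r : nat) :
  (nl <= r + rho - 1)%N -> cover_locality (VDB_code hdvd hS C) r rho.
Proof.
move=> hnl; split=> x; have [[i t] ->] := lineP x; exists (block_lines i).
  by split; [exact: block_lines_mem | rewrite card_block_lines |
    exact: block_rows_distance].
by split; [exact: block_lines_mem | rewrite card_block_lines |
    exact: block_cols_distance].
Qed.

End LocalGroup.

(** * Dimension and minimum cover distance *)

Section Partition.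

Context (hSpart : partition [set S j | j : 'I_(n %/ nl)] [set: 'I_n]).

Lemma coordinate_bij : bijective coordinate.
Proof.
have surj x : exists p, x == coordinate p.
  have : x \in cover [set S j | j : 'I_(n %/ nl)].
    by rewrite (cover_partition hSpart) inE.
  case/bigcupP=> _ /imsetP[j _ ->] /coordinateP[b ->].
  by exists (j, b).
(* A section of [coordinate] is injective between sets of size [n], hence bijective, and
   [coordinate] is its inverse. *)
pose g x := xchoose (surj x).
have gK : cancel g coordinate.
  by move=> x; have /eqP := xchooseP (surj x).
have g_bij : bijective g.
  by apply: (inj_card_bij (can_inj gK)); rewrite card_pos card_ord.
by case: g_bij => h _ hKg; exists g => // p; rewrite -[p]hKg gK.
Qed.

Lemma card_support (c : 'rV[F]_n) :
  #|[set p | c 0 (coordinate p) != 0]| = hamming_distance c 0.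
Proof.
rewrite /hamming_distance -(on_card_preimset (f := coordinate)).
  by apply: eq_card => p; rewrite !inE mxE.
by apply: onW_bij; exact: coordinate_bij.
Qed.

(** Every symbol of every word can be read off at some entry, since [coordinate] reaches all
    indices. *)
Lemma VDB_inj (T T' : 'I_n -> 'rV[F]_n) :
  VDB hdvd hS T = VDB hdvd hS T' -> T =1 T'.
Proof.
move=> eM x; have [s ->] := lineP x; apply/rowP=> y.
have [g _ gK] := coordinate_bij; rewrite -[y]gK -!VDB_entry.
by rewrite eM.
Qed.

Context (C : {set 'rV[F]_n}) (kC : nat) (hC : linear_code C kC).

Lemma VDB_linear_code : linear_code (VDB_code hdvd hS C) (kC * n).
Proof.
apply: linear_code_of_card => [|a M M' /imsetP[T /ffun_onP TC ->]|].
- by rewrite -VDB0; apply: VDB_codeP => _; exact: linear_code0 hC.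
- move=> /imsetP[T' /ffun_onP TC' ->]; rewrite -VDB_linear.
  by apply: VDB_codeP => i; exact: linear_codeP hC _ _ (TC i) (TC' i).
- rewrite card_imset => [|T T' /VDB_inj /ffunP //].
  by rewrite card_ffun_on card_ord (linear_code_card hC) expnM.
Qed.

Lemma VDB_weight_ge (d : nat) (M : 'M[F]_n) :
  ((d%:Z)%:E <= min_hamming_distance C)%E ->
  M \in VDB_code hdvd hS C -> M != 0 -> (d <= cover_weight M)%N.
Proof.
move=> hd /imsetP[T /ffun_onP TC ->] /mx_neq0[x [y]].
move=> /VDB_neq0[s [p [_ _ nz]]].
have c0 : T (line s) != 0 by apply: contraNneq nz => ->; rewrite mxE.
apply: leq_trans (min_hamming_distance_le hd (TC _) (linear_code0 hC) c0) _.
rewrite -card_support.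
(* The matching consists of all nonzero symbols of the word [line s], the one with [p] standing in
   row [line (cyc2 s p)] and column [line p]. *)
apply: (cover_weight_matching (f := line \o cyc2 s) (g := line)).
- by apply: in2W; apply: inj_comp (@cyc2_inj s); exact: line_inj.
- by apply: in2W; exact: line_inj.
- by move=> q; rewrite inE /= VDB_entry.
Qed.

Lemma VDB_weight_le (c : 'rV[F]_n) :
  (0 < n)%N -> c \in C -> c != 0 ->
  exists M, [/\ M \in VDB_code hdvd hS C, M != 0
              & (cover_weight M <= hamming_distance c 0)%N].
Proof.
move=> n_gt0 cC c0; pose i0 : 'I_n := Ordinal n_gt0.
pose T i := if i == i0 then c else 0.
exists (VDB hdvd hS T); split.
- apply: VDB_codeP => i; rewrite /T.
  by case: ifP => // _; exact: linear_code0 hC.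
- apply: contraNneq c0 => M0.
  by move: M0; rewrite -VDB0 => /VDB_inj/(_ i0); rewrite /T eqxx => ->.
(* Only [c] contributes nonzero entries, so the columns [line p] with [p] in its support form a
   cover. *)
- rewrite -card_support -(card_imset _ line_inj).
  apply: cover_weight_le_cols => x y /VDB_neq0[s [p [_ ->]]].
  rewrite /T; case: ifP => _ nz; first by rewrite imset_f // inE.
  by rewrite mxE eqxx in nz.
Qed.

Lemma VDB_min_cover_distance (d : nat) :
  (0 < n)%N -> min_hamming_distance C = (d%:Z)%:E ->
  min_cover_distance (VDB_code hdvd hS C) = (d%:Z)%:E.
Proof.
move=> n_gt0 hd; apply/le_anti/andP; split; last first.
  by apply: min_cover_distance_ge => M; apply: VDB_weight_ge; rewrite hd.
have [x [y [xC yC xy dxy]]] := min_hamming_distance_attained hd.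
(* By linearity a closest pair yields a nonzero word whose weight is the distance [d]. *)
have cC : x - y \in C by rewrite addrC -scaleN1r (linear_codeP _ hC).
have [|M [MC M0 wM]] := VDB_weight_le n_gt0 cC; first by rewrite subr_eq0.
apply: min_cover_distance_le MC M0 (leq_trans wM _).
rewrite -dxy; apply/subset_leq_card/subsetP => j.
by rewrite !inE !mxE subr_eq0.
Qed.

End Partition.

End Placement.

Theorem theorem2 (F : finFieldType) (n k r rho nl d : nat)
    (hn : (0 < n)%N) (hk : (0 < k)%N) (hr : (0 < r)%N) (hrho : (0 < rho)%N)
    (hnk : (n %| k)%N) (hrk : (r %| k)%N)
    (hnl : nl = (r + rho - 1)%N) (hdvd : (nl %| n)%N)
    (C : {set 'rV[F]_n})
    (hC : linear_code C (k %/ n))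
    (hd : min_hamming_distance C = (d%:Z)%:E)
    (S : 'I_(n %/ nl) -> {set 'I_n})
    (hSinj : injective S)
    (hSpart : partition [set S j | j : 'I_(n %/ nl)] [set: 'I_n])
    (hS : forall j, #|S j| = nl)
    (hSloc : forall j, ((rho%:Z)%:E <=
       min_hamming_distance [set restr_cols (S j) c | c in C])%E) :
  let CC := VDB_code hdvd hS C in
  [/\ linear_code CC k,
      min_cover_distance CC = (d%:Z)%:E,
      cover_locality CC r rho
    & d%:Z = lrc_bound n k r rho ->
      min_cover_distance CC = (lrc_bound n k r rho)%:E].
Proof.
move=> CC; have dist : min_cover_distance CC = (d%:Z)%:E.
  exact: (VDB_min_cover_distance hdvd hS hSpart hC hn hd).
split=> [|//||<- //].
- by rewrite -(divnK hnk); exact: (VDB_linear_code hdvd hS hSpart hC).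
- by apply: VDB_cover_locality (linear_code0 hC) hSloc _ _; rewrite hnl.
Qed.
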